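(* Let $X$, $Y$, $\mathcal{S}$, $\mathcal{R}$, $\phi$ satisfy conditions (C1)–(C6) listed in the context, with $p$ the exponent in (C5). Let $y\in Y$ and assume that $y$ has an $\mathcal{S}$-solution. Let $y_k\in Y$ with $\mathcal{D}(y_k,y)\le\delta_k$ and $\delta_k\to0$. Choose $\alpha=\alpha(\delta)>0$ such that $\alpha_k:=\alpha(\delta_k)$ satisfies $\lim_k\alpha_k=\lim_k\delta_k^p/\alpha_k=0$. Assume that $x_k\in X$ and $z_k\in X^*$ are such that $$z_k\in\partial_{\alpha_k\phi}\big(\mathcal{S}(\cdot,y_k)+\alpha_k\mathcal{R}(\cdot)\big)(x_k),\qquad \frac{\|z_k\|}{\alpha_k}\to0,\qquad\langle z_k,x_k\rangle\le0.$$ Then the sequence $(x_k)_k$ has a weakly convergent subsequence, and the limit $x_+$ of any weakly convergent subsequence is an $\mathcal{S}$-solution of $y$. Moreover, $\mathcal{R}(x_+)\le\mathcal{R}(u)+\phi(u)$ for every $\mathcal{S}$-solution $u$ of $y$. Finally, whenever the $\mathcal{S}$-solution of $y$ is unique, $(x_k)_k$ converges weakly to this solution.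
   Context: An element $z\in X$ is called an $\mathcal{S}$-solution of $y\in Y$ if $\mathcal{S}(z,y)=0$. Relative subgradients: for a Banach space $X$ with dual $X^*$, $F\colon X\to\mathbb{R}$ and $\psi\colon X\to[0,\infty)$, the set $\partial_\psi F(x)$ consists of all $r\in X^*$ with $F(x)+\langle r,u-x\rangle\le F(u)+\psi(u)$ for all $u\in X$. $F$ is relatively sub-differentiable with bound $\psi$ if $\partial_\psi F(x)\ne\emptyset$ for all $x\in X$. Setting: $\mathcal{S}\colon X\times Y\to[0,\infty)$, $\mathcal{R}\colon X\to[0,\infty)$, $\phi\colon X\to[0,\infty)$, $\mathcal{T}_{\alpha,y}(x)=\mathcal{S}(x,y)+\alpha\mathcal{R}(x)$ and: (C1) $X$ is a reflexive Banach space and $Y$ is a metric space with metric $\mathcal{D}$. (C2) $\mathcal{R}$ is weakly sequentially lower semi-continuous. (C3) $\mathcal{R}$ is relatively sub-differentiable with bound $\phi$. (C4) $\mathcal{S}$ is weakly sequentially lower semi-continuous (i.e. $x_k\rightharpoonup x$ weakly in $X$ and $y_k\to y$ in $Y$ imply $\mathcal{S}(x,y)\le\liminf_k\mathcal{S}(x_k,y_k)$), convex in its first argument and continuous in its second argument. (C5) There exist $C>0$ and $p\ge1$ such that $\mathcal{S}(z,y)\le C\big(\mathcal{S}(z,y')+\mathcal{D}(y,y')^p\big)$ for all $z\in X$ and $y,y'\in Y$. (C6) For all $\alpha>0$ and $y\in Y$ the functional $\mathcal{T}_{\alpha,y}$ is coercive, i.e. $\mathcal{T}_{\alpha,y}(x)\to\infty$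 as $\|x\|\to\infty$. *)

(* Defs.v *)
From HB Require Import structures.
From mathcomp Require Import all_boot all_order all_algebra.
From mathcomp Require Import all_classical all_reals all_analysis.

Set Implicit Arguments.
Unset Strict Implicit.
Unset Printing Implicit Defensive.

Import Order.TTheory GRing.Theory Num.Theory.
Import numFieldNormedType.Exports.

Local Open Scope classical_set_scope.
Local Open Scope ring_scope.

Section Dual.
Context {R : realType} (X : normedModType R).

Definition continuous_linear_form : {pred X -> R^o} :=
  [pred f | `[< linear f /\ continuous f >]].

Lemma continuous_linear_formP (f : X -> R^o) :
  reflect (linear f /\ continuous f) (f \in continuous_linear_form).
Proof. exact: asboolP. Qed.

Lemma continuous_linear_form_submod : submod_closed continuous_linear_form.
Proof.
split=> [|a f g /continuous_linear_formP[lf cf] /continuous_linear_formP[lg cg]].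
  apply/continuous_linear_formP; split; last exact: cst_continuous.
  by move=> a x y; rewrite /= scaler0 addr0.
apply/continuous_linear_formP; split=> [b x y|x].
  by rewrite !fctE lf lg; rewrite !scalerDr addrACA !scalerA [a * b]mulrC.
apply: cvgD; last exact: cg.
by apply: cvgZr; exact: cf.
Qed.

HB.instance Definition _ := GRing.isSubmodClosed.Build R (X -> R^o)
  continuous_linear_form continuous_linear_form_submod.

Record dual := Dual {
  dual_val :> X -> R^o ;
  dual_valP : dual_val \in continuous_linear_form }.

HB.instance Definition _ := [isSub for dual_val].
HB.instance Definition _ := [Choice of dual by <:].
HB.instance Definition _ := [SubChoice_isSubLmodule of dual by <:].

Implicit Types f g : dual.

Lemma dual_linear f : linear f.
Proof. by have /continuous_linear_formP[] := dual_valP f. Qed.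

HB.instance Definition _ f :=
  GRing.isLinear.Build R X R^o *:%R (dual_val f) (dual_linear f).

Lemma dual_continuous f : continuous f.
Proof. by have /continuous_linear_formP[] := dual_valP f. Qed.

Lemma dualP f g : f =1 g -> f = g.
Proof. by move=> fg; apply/val_inj/funext. Qed.

Lemma dualD f g x : (f + g) x = f x + g x. Proof. by []. Qed.

Lemma dualZ (a : R) f x : (a *: f) x = a * f x. Proof. by []. Qed.

Definition dual_norm f : R := sup [set `|f x| | x in [set x | `|x| <= 1]].

Lemma has_sup_dual_norm f : has_sup [set `|f x| | x in [set x | `|x| <= 1]].
Proof.
split; first by exists `|f 0|, 0 => //=; rewrite normr0.
have /linear_boundedP/pinfty_ex_gt0[M M0 fM] :
    bounded_near (dual_val f) (nbhs (0 : X)).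
  exact/linear_bounded_continuous/dual_continuous.
exists M => _ [x /= x1 <-]; rewrite (le_trans (fM x))//.
by rewrite ler_piMr// ltW.
Qed.

Lemma dual_norm_ge0 f : 0 <= dual_norm f.
Proof.
rewrite (le_trans (normr_ge0 (f 0)))//; apply: sup_upper_bound.
  exact: has_sup_dual_norm.
by exists 0 => //=; rewrite normr0.
Qed.

Lemma dual_norm_bound f x : `|f x| <= dual_norm f * `|x|.
Proof.
have [->|x0] := eqVneq x 0; first by rewrite linear0 !normr0 mulr0.
have nx0 : 0 < `|x| by rewrite normr_gt0.
rewrite -ler_pdivrMr//; apply: sup_upper_bound; first exact: has_sup_dual_norm.
exists (`|x|^-1 *: x) => /=.
  by rewrite normrZ normfV normr_id mulVf// gt_eqF.
by rewrite linearZ/= normrM normfV normr_id mulrC.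
Qed.

Lemma dual_norm_le f (M : R) :
  (forall x, `|x| <= 1 -> `|f x| <= M) -> dual_norm f <= M.
Proof.
move=> fM; apply: ge_sup; first by have [] := has_sup_dual_norm f.
by move=> _ [x /= x1 <-]; exact: fM.
Qed.

Lemma dual_normD f g : dual_norm (f + g) <= dual_norm f + dual_norm g.
Proof.
apply: dual_norm_le => x x1; rewrite dualD (le_trans (ler_normD _ _))//.
by rewrite lerD// (le_trans (dual_norm_bound _ _))// ler_piMr// dual_norm_ge0.
Qed.

Lemma dual_normZ (a : R) f : dual_norm (a *: f) = `|a| * dual_norm f.
Proof.
have le (b : R) g : dual_norm (b *: g) <= `|b| * dual_norm g.
  apply: dual_norm_le => x x1; rewrite dualZ normrM ler_wpM2l//.
  by rewrite (le_trans (dual_norm_bound _ _))// ler_piMr// dual_norm_ge0.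
apply/eqP; rewrite eq_le le/=.
have [->|a0] := eqVneq a 0; first by rewrite normr0 mul0r dual_norm_ge0.
rewrite -ler_pdivlMl ?normr_gt0// -normfV.
by rewrite -{1}[f](scalerK a0) le.
Qed.

Lemma dual_norm0_eq0 f : dual_norm f = 0 -> f = 0.
Proof.
move=> f0; apply: dualP => x; apply/eqP; rewrite -normr_le0.
by rewrite (le_trans (dual_norm_bound f x))// f0 mul0r.
Qed.

HB.instance Definition _ :=
  Lmodule_isNormed.Build R dual dual_normD dual_normZ dual_norm0_eq0.

Lemma dual_normE f :
  `|f| = sup [set `|f x| | x in [set x | `|x| <= 1]].
Proof. by []. Qed.

End Dual.

Section Definitions.
Context {R : realType}.

Definition reflexive_space (X : normedModType R) : Prop :=
  forall Phi : dual (dual X), exists x : X, forall f : dual X, Phi f = f x.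

Definition weakly_cvg (X : normedModType R) (x : nat -> X) (l : X) : Prop :=
  forall f : dual X, (f (x k) : R) @[k --> \oo] --> (f l : R).

Definition weakly_seq_lsc (X : normedModType R) (F : X -> R) : Prop :=
  forall (x : nat -> X) (l : X), weakly_cvg x l ->
    ((F l)%:E <= limn_einf (fun k => (F (x k))%:E))%E.

Definition weakly_seq_lsc2 (X : normedModType R) (Y : metricType R)
    (S : X -> Y -> R) : Prop :=
  forall (x : nat -> X) (l : X) (y : nat -> Y) (m : Y),
    weakly_cvg x l -> y @ \oo --> m ->
    ((S l m)%:E <= limn_einf (fun k => (S (x k) (y k))%:E))%E.

Definition rel_subdifferential (X : normedModType R) (psi F : X -> R) (x : X)
    : set (dual X) :=
  [set r | forall u : X, F x + r (u - x) <= F u + psi u].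

Definition rel_subdifferentiable (X : normedModType R) (psi F : X -> R) : Prop :=
  forall x : X, rel_subdifferential psi F x !=set0.

Definition coercive (X : normedModType R) (F : X -> R) : Prop :=
  forall M : R, exists r : R, forall x : X, r <= `|x| -> M <= F x.

Definition tikhonov (X : normedModType R) (Y : metricType R)
    (S : X -> Y -> R) (Reg : X -> R) (alpha : R) (y : Y) (x : X) : R :=
  S x y + alpha * Reg x.

Definition S_solution (X : normedModType R) (Y : metricType R)
    (S : X -> Y -> R) (y : Y) (z : X) : Prop :=
  S z y = 0.

End Definitions.

(* Main.v *)
(** Testing the subgradient inequality at an S-solution u of y and dividing by
  alpha_k gives R(x_k) <= R(u) + phi(u) + o(1) and S(x_k, y_k) = o(1); (C5) and
  the coercivity of T_(1,y) then bound (x_k), and lower semicontinuity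
  identifies the weak limits.

  The weak sequential compactness of bounded sequences in a reflexive space X
  goes through ultrafilters: along an ultrafilter U, the map
  f |-> lim_U f(x_k) is an element of the bidual, hence the evaluation at some
  w, which by Hahn-Banach lies in the closed span of (x_k). Countably many
  norming functionals separate the points of this span, so a subsequence along
  which all of them converge to their values at w has w as its only weak
  ultrafilter limit, and thus converges weakly to w. *)

From HB Require Import structures.
Require Import Defs.
From mathcomp Require Import all_boot all_order all_algebra.
From mathcomp Require Import all_classical all_reals all_analysis.
From mathcomp Require Import ring lra.

Set Implicit Arguments.
Unset Strict Implicit.
Unset Printing Implicit Defensive.

Import Order.TTheory GRing.Theory Num.Theory.
Import numFieldNormedType.Exports.

Local Open Scope classical_set_scope.
Local Open Scope ring_scope.

(** * The Hahn-Banach theorem *)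

Section HahnBanach.
Context {R : realType} {X : lmodType R}.
Implicit Types (p q : X -> R) (x y w : X).

Definition sublinear p : Prop :=
  (forall x y, p (x + y) <= p x + p y) /\
  (forall t x, 0 < t -> p (t *: x) <= t * p x).

Lemma sublinearZ p t x : sublinear p -> 0 < t -> p (t *: x) = t * p x.
Proof.
move=> [_ pZ] t0; apply/eqP; rewrite eq_le pZ//=.
have := pZ t^-1 (t *: x); rewrite invr_gt0 scalerA mulVf ?gt_eqF// scale1r.
by move=> /(_ t0); rewrite ler_pdivlMl.
Qed.

Lemma sublinear0 p : sublinear p -> p 0 = 0.
Proof.
move=> sp; have := sublinearZ 0 sp (ltr0n R 2); rewrite scaler0.
by move=> h; lra.
Qed.

Lemma sublinear_ge p x : sublinear p -> - p (- x) <= p x.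
Proof.
by move=> sp; have := sp.1 x (- x); rewrite subrr sublinear0//; lra.
Qed.

(** For sublinear [p], a minorant of [p] whose value at [- w] is at most [- p w]: a linear
    functional below it takes the value [p w] at [w]. *)
Definition tilt p w x : R :=
  inf [set p (x + t *: w) - t * p w | t in [set t | 0 <= t]].

Lemma tilt_lb p w x t : sublinear p -> 0 <= t ->
  - p (- x) <= p (x + t *: w) - t * p w.
Proof.
move=> sp; rewrite le_eqVlt => /predU1P[<-|t0].
  by rewrite scale0r addr0 mul0r subr0 sublinear_ge.
rewrite -sublinearZ//.
by have := sp.1 (- x) (x + t *: w); rewrite addKr; lra.
Qed.

Lemma tilt_le p w x t : sublinear p -> 0 <= t ->
  tilt p w x <= p (x + t *: w) - t * p w.
Proof.
move=> sp t0; apply: ge_inf; last by exists t.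
by exists (- p (- x)) => _ [s /= s0 <-]; exact: tilt_lb.
Qed.

Lemma le_tilt p w x (b : R) :
  (forall t, 0 <= t -> b <= p (x + t *: w) - t * p w) -> b <= tilt p w x.
Proof.
move=> bp; apply: lb_le_inf; first by exists (p (x + 0 *: w) - 0 * p w), 0 => /=.
by move=> _ [t /= t0 <-]; exact: bp.
Qed.

Lemma tilt_le_id p w x : sublinear p -> tilt p w x <= p x.
Proof.
by move=> sp; have := tilt_le w x sp (lexx 0); rewrite scale0r addr0 mul0r subr0.
Qed.

Lemma tiltN p w : sublinear p -> tilt p w (- w) <= - p w.
Proof.
move=> sp; have := tilt_le w (- w) sp ler01.
by rewrite scale1r addNr sublinear0// mul1r sub0r.
Qed.

Lemma sublinear_tilt p w : sublinear p -> sublinear (tilt p w).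
Proof.
move=> sp; split=> [x y|t x t0].
  rewrite -lerBlDr; apply: le_tilt => t t0.
  rewrite lerBlDl -lerBlDr; apply: le_tilt => s s0.
  (* The parameters [t] for [x] and [s] for [y] add up to one for [x + y]. *)
  rewrite lerBlDr (le_trans (tilt_le _ _ sp (addr_ge0 t0 s0)))//.
  have := sp.1 (x + t *: w) (y + s *: w).
  by rewrite addrACA -scalerDl; lra.
rewrite -ler_pdivrMl//; apply: le_tilt => s s0.
rewrite ler_pdivrMl//.
have := tilt_le w (t *: x) sp (mulr_ge0 (ltW t0) s0).
by rewrite -scalerA -scalerDr (sublinearZ _ sp)//; lra.
Qed.

(* A functional that is minimal among the sublinear ones coincides with all its
   tilts, hence is odd. *)
Lemma minimal_sublinear_odd q : sublinear q ->
  (forall q', sublinear q' -> (forall x, q' x <= q x) -> q' = q) ->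
  forall x, q (- x) = - q x.
Proof.
move=> sq qmin x; apply/eqP; rewrite eq_le; apply/andP; split; last first.
  by have := sublinear_ge x sq; lra.
have := tiltN x sq; rewrite (qmin (tilt q x))//; first exact: sublinear_tilt.
by move=> y; exact: tilt_le_id.
Qed.

(** Oddness turns subadditivity at [- x], [- y] into the reverse inequality and carries homogeneity
    over to negative scalars. *)
Lemma odd_sublinear_linear q : sublinear q -> (forall x, q (- x) = - q x) ->
  linear (q : X -> R^o).
Proof.
move=> sq qN.
have qD x y : q (x + y) = q x + q y.
  apply/eqP; rewrite eq_le sq.1/=.
  by have := sq.1 (- x) (- y); rewrite -opprD !qN; lra.
move=> a x y; rewrite qD; congr (_ + _).
have [a0|a0|->] := ltgtP a 0; last by rewrite !scale0r sublinear0.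
- by rewrite -[a]opprK scaleNr qN sublinearZ ?oppr_gt0// scaleNr.
- exact: sublinearZ.
Qed.

Lemma minimal_sublinear p : sublinear p -> exists q,
  [/\ sublinear q, forall x, q x <= p x &
    forall q', sublinear q' -> (forall x, q' x <= q x) -> q' = q].
Proof.
move=> sp.
pose T := {q | sublinear q /\ forall x, q x <= p x}.
(* The order is reversed, so that Zorn's maximal element is pointwise minimal. *)
pose r (q q' : T) := `[< forall x, sval q' x <= sval q x >].
have [| | | |q qmax] := @Zorn T r.
- by move=> q; apply/asboolP.
- move=> q1 q2 q3 /asboolP q12 /asboolP q23; apply/asboolP => x.
  exact: le_trans (q23 x) (q12 x).
- move=> [q1 h1] [q2 h2] /asboolP/= q12 /asboolP/= q21; apply: eq_exist => /=.
  by apply/funext => x; apply/eqP; rewrite eq_le q12 q21.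
- move=> A totA; have [->|/set0P[q0 Aq0]] := eqVneq A set0.
    by exists (exist _ p (conj sp (fun=> lexx _))) => s [].
  (* A chain is bounded by its pointwise infimum, finite because [- p (- x)] lies below every
     sublinear minorant of [p]. *)
  pose m x := inf [set sval q x | q in A].
  have lbA x : lbound [set sval q x | q in A] (- p (- x)).
    move=> _ [[q [sq qp]] _ <-] /=.
    by rewrite (le_trans _ (sublinear_ge x sq))// lerN2.
  have m_le x (q : T) : A q -> m x <= sval q x.
    by move=> Aq; apply: ge_inf; [exists (- p (- x)); exact: lbA|exists q].
  have m_ge x b : (forall q : T, A q -> b <= sval q x) -> b <= m x.
    move=> bA; apply: lb_le_inf; first by exists (sval q0 x), q0.
    by move=> _ [q Aq <-]; exact: bA.
  have sm : sublinear m.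
    split=> [x y|t x t0].
      rewrite -lerBlDr; apply/m_ge => q Aq.
      rewrite lerBlDl -lerBlDr; apply/m_ge => q' Aq'.
      (* In a chain, the smaller of [q] and [q'] can serve both arguments. *)
      rewrite lerBlDr; have [/asboolP h|/asboolP h] := totA _ _ Aq Aq'.
        rewrite (le_trans (m_le _ _ Aq'))//.
        by have := (svalP q').1.1 x y; have := h x; lra.
      rewrite (le_trans (m_le _ _ Aq))//.
      by have := (svalP q).1.1 x y; have := h y; lra.
    rewrite -ler_pdivrMl//; apply/m_ge => q Aq; rewrite ler_pdivrMl//.
    by rewrite -(sublinearZ _ (svalP q).1)// m_le.
  have mp x : m x <= p x by exact: le_trans (m_le _ _ Aq0) ((svalP q0).2 x).
  exists (exist _ m (conj sm mp)) => s As; apply/asboolP => x /=; exact: m_le.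
exists (sval q); split; [exact: (svalP q).1|exact: (svalP q).2|].
move=> q' sq' q'q.
have q'p x : q' x <= p x := le_trans (q'q x) ((svalP q).2 x).
by have <- := qmax (exist _ q' (conj sq' q'p)) (introT (asboolP _) q'q).
Qed.

Theorem hahn_banach p w : sublinear p -> exists f : X -> R^o,
  [/\ linear f, forall x, f x <= p x & f w = p w].
Proof.
move=> sp; have [q [sq qp qmin]] := minimal_sublinear (sublinear_tilt w sp).
have qN := minimal_sublinear_odd sq qmin.
have qlep x : q x <= p x by rewrite (le_trans (qp x))// tilt_le_id.
exists q; split; [exact: odd_sublinear_linear|exact: qlep|].
apply/eqP; rewrite eq_le qlep/=.
by have := le_trans (qp (- w)) (tiltN w sp); rewrite qN lerN2.
Qed.

End HahnBanach.

(** * Bounded functionals and density by annihilators *)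

Section Functionals.
Context {R : realType} {X : normedModType R}.
Implicit Types (x w : X) (W : set X).

Lemma bounded_linear_dual (f : X -> R^o) (K : R) : linear f ->
  (forall x, f x <= K * `|x|) ->
  exists2 g : dual X, forall x, g x = f x & forall x, `|g x| <= K * `|x|.
Proof.
move=> lf fK.
pose F : {linear X -> R^o} := HB.pack f (GRing.isLinear.Build R X R^o *:%R f lf).
have FK x : `|F x| <= K * `|x|.
  by rewrite ler_norml fK andbT lerNl -linearN -[`|x|]normrN fK.
suff fP : f \in @continuous_linear_form R X by exists (Dual fP).
apply/continuous_linear_formP; split=> //.
have bF : bounded_near F (nbhs (0 : X)).
  apply/linear_boundedP; exists K; split=> [|r Kr x]; first exact: num_real.
  by rewrite (le_trans (FK x))// ler_wpM2r// ltW.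
exact: bounded_linear_continuous bF.
Qed.

Lemma hahn_banach_dual (p : X -> R) w : sublinear p -> (forall x, p x <= `|x|) ->
  exists f : dual X,
    [/\ forall x, f x <= p x, forall x, `|f x| <= `|x| & f w = p w].
Proof.
move=> sp pn; have [f [lf fp fw]] := hahn_banach w sp.
have [|g gf gn] := bounded_linear_dual (K := 1) lf.
  by move=> x; rewrite mul1r (le_trans (fp x)).
exists g; split=> [x|x|]; [by rewrite gf| |by rewrite gf].
by have := gn x; rewrite mul1r.
Qed.

Lemma norming_functional w :
  exists f : dual X, f w = `|w| /\ forall x, `|f x| <= `|x|.
Proof.
have sn : sublinear (fun x : X => `|x|).
  by split=> [x y|t x t0]; [exact: ler_normD|rewrite normrZ gtr0_norm].
by have [f [_ fn fw]] := hahn_banach_dual w sn (fun=> lexx _); exists f.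
Qed.

Definition dist W x : R := inf [set `|x - v| | v in W].

Lemma dist_le W x v : W v -> dist W x <= `|x - v|.
Proof. by move=> Wv; apply: ge_inf; [exists 0 => _ [u _ <-]|exists v]. Qed.

Lemma le_dist W x b : W !=set0 -> (forall v, W v -> b <= `|x - v|) ->
  b <= dist W x.
Proof.
move=> [v Wv] bW; apply: lb_le_inf; first by exists `|x - v|, v.
by move=> _ [u Wu <-]; exact: bW.
Qed.

Section RationalSubspace.
Variable W : set X.
Hypotheses (W0 : W 0) (WD : forall u v, W u -> W v -> W (u + v)).
Hypothesis WZ : forall (a : rat) v, W v -> W (ratr a *: v).

(** In the application [W] is countable, hence only a rational subspace; homogeneity in real [t]
    comes from approximating [t] by rationals from above. *)
Lemma sublinear_dist : sublinear (dist W).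
Proof.
have Wn0 : W !=set0 by exists 0.
split=> [x y|t x t0].
  rewrite -lerBlDr; apply: le_dist => // u Wu.
  rewrite lerBlDl -lerBlDr; apply: le_dist => // v Wv.
  rewrite lerBlDr (le_trans (dist_le _ (WD Wu Wv)))// [leRHS]addrC.
  by rewrite opprD addrACA ler_normD.
rewrite -ler_pdivrMl//; apply: le_dist => // v Wv; rewrite ler_pdivrMl//.
apply/ler_addgt0Pr => e e0.
have v1 : 0 < `|v| + 1 by rewrite ltr_wpDl.
(* The margin keeps the error [(ratr a - t) *: v] within [e]; the added 1 avoids dividing by
   zero. *)
have : t < t + e / (`|v| + 1) by rewrite ltrDl divr_gt0.
move=> /rat_in_itvoo[a]; rewrite in_itv/= => /andP[ta ae].
rewrite (le_trans (dist_le _ (WZ a Wv)))//.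
have -> : t *: x - ratr a *: v = t *: (x - v) + (t - ratr a) *: v.
  by rewrite scalerBr scalerBl addrA subrK.
rewrite (le_trans (ler_normD _ _))// normrZ gtr0_norm// lerD2l normrZ.
rewrite ltr0_norm ?subr_lt0// opprB.
have : (ratr a - t) * (`|v| + 1) <= e by rewrite -ler_pdivlMr// lerBlDl ltW.
by apply: le_trans; rewrite ler_wpM2l// ?subr_ge0 ?ltW// ltrDl.
Qed.

(** A functional dominated by the distance to [W], with equality at [w], vanishes on [W]; the
    hypothesis then makes the distance of [w] zero. *)
Lemma dense_of_annihilator w :
  (forall f : dual X, (forall v, W v -> f v = 0) -> f w = 0) ->
  forall e, 0 < e -> exists2 v, W v & `|w - v| < e.
Proof.
move=> annW e e0.
have [|f [fd _ fw]] := hahn_banach_dual w sublinear_dist.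
  by move=> x; rewrite (le_trans (dist_le x W0))// subr0.
have dW v : W v -> dist W v <= 0.
  by move=> Wv; rewrite (le_trans (dist_le v Wv))// subrr normr0.
have fW v : W v -> f v = 0.
  move=> Wv; apply/eqP; rewrite eq_le (le_trans (fd v) (dW v Wv))/=.
  have := WZ (-1) Wv; rewrite rmorphN1 scaleN1r => /dW /(le_trans (fd _)).
  by rewrite linearN oppr_le0.
have : dist W w < e by rewrite -fw annW.
by move=> /inf_lt[|_ [v Wv <-] ve]; [exists `|w - 0|, 0|exists v].
Qed.

End RationalSubspace.
End Functionals.

(** * Weak sequential compactness in reflexive spaces *)

Section Ultrafilters.

Lemma ultra_fmap (T U : Type) (f : T -> U) (F : set_system T) :
  UltraFilter F -> UltraFilter (f @ F).
Proof.
move=> FU; have PF : ProperFilter F := ultra_proper.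
split=> [|G PG FG]; first exact: fmap_proper_filter.
apply/seteqP; split=> // A GA.
have [//|FnA] := in_ultra_setVsetC (f @^-1` A) FU.
have /FG GnA : (f @ F) (~` A) by [].
by have /filter_ex[y []] : G (A `&` ~` A) by exact: filterI.
Qed.

Lemma ultra_bounded_cvg (R : realType) (T : Type) (F : set_system T) (u : T -> R)
    (K : R) : UltraFilter F -> (forall t, `|u t| <= K) -> cvg (u @ F).
Proof.
move=> FU uK; have PF : ProperFilter F := ultra_proper.
have FuK : (u @ F) `[- K, K]%classic.
  by rewrite /fmap/=; apply: filterE => t /=; rewrite in_itv/= -ler_norml.
have := @segment_compact R (- K) K; rewrite compact_ultra.
move=> /(_ _ (ultra_fmap u FU) FuK)[l [_ ul]].
by apply/cvg_ex; exists l.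
Qed.

(** If the preimage of a neighbourhood of [l] were not in [F], some ultrafilter finer than [F] would
    contain its complement. *)
Lemma cvg_ultra (T : Type) (U : topologicalType) (F : set_system T) (f : T -> U)
    (l : U) : Filter F ->
  (forall G, UltraFilter G -> F `<=` G -> f @ G --> l) -> f @ F --> l.
Proof.
move=> FF fG A lA; apply: contrapT => nFA.
have PG : ProperFilter (within (~` (f @^-1` A)) F).
  split; last exact: within_filter.
  rewrite /within/= => F0; apply: nFA.
  by apply: filterS F0 => t nnA; apply: contrapT; exact: nnA.
have [G [GU FG]] := ultraFilterLemma PG.
have PrG : ProperFilter G := ultra_proper.
have GA : G (f @^-1` A).
  by apply: fG lA => P FP; apply: FG; apply: filterS FP.
have GnA : G (~` (f @^-1` A)) by apply: FG; rewrite /within/=; exact: filterE.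
by have /filter_ex[t []] : G (f @^-1` A `&` ~` (f @^-1` A)) by exact: filterI.
Qed.

End Ultrafilters.

(** The conditions may tighten with [k], so this does the work of a diagonal extraction. *)
Lemma frequently_subseq (P : nat -> nat -> Prop) :
  (forall k N, exists2 n, (N <= n)%N & P k n) ->
  exists s : nat -> nat, increasing_seq s /\ forall k, P k (s k).
Proof.
move=> freq.
have [g gP] : {g : nat -> nat -> nat |
    forall k N, (N <= g k N)%N /\ P k (g k N)}.
  apply: cid; have /choice[g gP] : forall kN : nat * nat,
      exists n, (kN.2 <= n)%N /\ P kN.1 n.
    by move=> [k N]; have [n ? ?] := freq k N; exists n.
  by exists (fun k N => g (k, N)) => k N; exact: (gP (k, N)).
pose s := fix s k := if k is k'.+1 then g k (s k').+1 else g 0%N 0%N.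
exists s; split; last by case=> [|k]; exact: (gP _ _).2.
by apply/increasing_seqP => k; exact: (gP k.+1 (s k).+1).1.
Qed.

Section WeakCompactness.
Context {R : realType} {X : normedModType R}.
Implicit Types (x : nat -> X) (w : X).

Lemma reflexive_ultralimit x (M : R) (U : set_system nat) :
  reflexive_space X -> (forall k, `|x k| <= M) -> UltraFilter U ->
  exists w, forall f : dual X, (f (x k) : R) @[k --> U] --> (f w : R).
Proof.
move=> reflX xM UU; have PU : ProperFilter U := ultra_proper.
have fxM (f : dual X) k : `|f (x k)| <= M * `|f|.
  by rewrite (le_trans (dual_norm_bound f _))// mulrC ler_wpM2r// dual_norm_ge0.
have cvf (f : dual X) : cvg ((f (x k) : R) @[k --> U]).
  exact: ultra_bounded_cvg (fxM f).
pose Phi (f : dual X) : R^o := lim ((f (x k) : R) @[k --> U]).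
have PhiP (f : dual X) : (f (x k) : R) @[k --> U] --> (Phi f : R) by exact: cvf.
have lPhi : linear Phi.
  move=> a f g; apply: cvg_lim => //.
  by apply: cvgD; [apply: cvgM; [exact: cvg_cst|exact: PhiP]|exact: PhiP].
have PhiM f : Phi f <= M * `|f|.
  apply: limr_le; first exact: cvf.
  by apply: filterE => k; rewrite (le_trans (ler_norm _)).
have [Psi PsiE _] := bounded_linear_dual lPhi PhiM.
have [w wP] := reflX Psi.
by exists w => f; rewrite -wP PsiE; exact: PhiP.
Qed.

(** Such lists form a countable type, so norming functionals for all combinations can be
    enumerated. *)
Definition rational_comb x (c : seq (rat * nat)) : X :=
  \sum_(i <- c) ratr i.1 *: x i.2.

Lemma dense_rational_comb x w :
  (forall f : dual X, (forall k, f (x k) = 0) -> f w = 0) ->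
  forall e, 0 < e -> exists c, `|w - rational_comb x c| < e.
Proof.
move=> annw e e0.
have [| | | |_ [c _ <-] we] :=
  @dense_of_annihilator R X (range (rational_comb x)) _ _ _ w _ e e0.
- by exists [::] => //; rewrite /rational_comb big_nil.
- by move=> _ _ [c _ <-] [d _ <-]; exists (c ++ d); rewrite // /rational_comb big_cat.
- move=> a _ [c _ <-]; exists [seq (a * i.1, i.2) | i <- c] => //.
  rewrite /rational_comb big_map scaler_sumr; apply: eq_bigr => i _ /=.
  by rewrite rmorphM scalerA.
- move=> f fW; apply: annw => k; apply: fW; exists [:: (1, k)] => //.
  by rewrite /rational_comb big_seq1 rmorph1 scale1r.
by exists c.
Qed.

Theorem reflexive_weakly_cvg_subseq x (M : R) : reflexive_space X ->
  (forall k, `|x k| <= M) ->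
  exists (s : nat -> nat) w, increasing_seq s /\ weakly_cvg (x \o s) w.
Proof.
move=> reflX xM.
have [F FP] : {F : seq (rat * nat) -> dual X | forall c,
    F c (rational_comb x c) = `|rational_comb x c| /\ forall u, `|F c u| <= `|u|}.
  apply: cid; have /choice[F FP] c := norming_functional (rational_comb x c).
  by exists F.
(* Codes that decode to no list default to [[::]]; every [F c] is still reached. *)
pose g j := F (odflt [::] (unpickle j)).
have gF c : g (pickle c) = F c by rewrite /g pickleK.
have [U [UU ooU]] := ultraFilterLemma (@eventually_filter : ProperFilter \oo).
have PU : ProperFilter U := ultra_proper.
have [w wU] := reflexive_ultralimit reflX xM UU.
have [k N|s [incs gs]] := @frequently_subseq
    (fun k n => forall j, (j < k)%N -> `|g j w - g j (x n)| <= k.+1%:R^-1).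
  (* A set in [U] meets every tail, since [U] is finer than [\oo]. *)
  have : U [set n | forall j, (j < k)%N -> `|g j w - g j (x n)| <= k.+1%:R^-1].
    have e0 : 0 < k.+1%:R^-1 :> R by rewrite invr_gt0.
    (* Induction on the number of functionals only; the tolerance stays fixed. *)
    elim: {1}k => [|m IHm]; first by apply: filterE.
    have /cvgrPdist_le/(_ _ e0) := wU (g m).
    apply: filterS2 IHm => n IHn gn j; rewrite ltnS leq_eqVlt => /predU1P[->//|].
    exact: IHn.
  have /ooU : \oo [set n | (N <= n)%N] by exact: nbhs_infty_ge.
  by move=> UN UP; have [n [Nn Pn]] := filter_ex (filterI UN UP); exists n.
exists s, w; split=> // f.
have gsw j : (g j (x (s k)) : R) @[k --> \oo] --> (g j w : R).
  apply/cvgrPdist_le => e e0; near=> k.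
  rewrite (le_trans (gs k j _))//; first by near: k; exact: nbhs_infty_gt.
  by apply: ltW; near: k; exact: (near_infty_natSinv_lt (PosNum e0)).
(* It suffices that the weak limit [w'] of the subsequence along any ultrafilter [V] finer than
   [\oo] equals [w]. *)
apply: cvg_ultra => V UV ooV.
have PV : ProperFilter V := ultra_proper.
have [w' w'V] := reflexive_ultralimit reflX (fun k => xM (s k)) UV.
suff <- : w' = w by exact: w'V.
(* A functional that kills the sequence kills its weak limits, hence [w' - w]. *)
have annx v (G : set_system nat) (t : nat -> nat) (h : dual X) : ProperFilter G ->
    (h (x (t k)) : R) @[k --> G] --> (h v : R) ->
    (forall k, h (x k) = 0) -> h v = 0.
  move=> PG hv hx; apply: (cvg_unique _ hv) => //.
  apply/cvgrPdist_le => e e0; apply: filterE => k.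
  by rewrite hx subrr normr0 ltW.
have gw j : g j (w' - w) = 0.
  rewrite linearB; apply/eqP; rewrite subr_eq0; apply/eqP.
  apply: (cvg_unique _ (w'V (g j))) => //.
  by apply: cvg_trans (gsw j) => A; exact: ooV.
apply/eqP; rewrite -subr_eq0 -normr_le0; apply/ler_addgt0Pr => e e0.
(* The functional norming the combination kills [w' - w], so the combination is no longer than the
   approximation error; each is below [e / 2]. *)
have [h hx|c wc] := @dense_rational_comb x (w' - w) _ _ (divr_gt0 e0 (ltr0n R 2)).
  by rewrite linearB/= (annx w' V s h)// (annx w U id h)// subr0.
have [Fc Fn] := FP c.
have : `|rational_comb x c| <= `|w' - w - rational_comb x c|.
  by rewrite -Fc (le_trans _ (Fn _))// linearB/= -gF gw sub0r normrN ler_norm.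
have := ler_distD (rational_comb x c) (w' - w) 0.
by rewrite !subr0; lra.
Unshelve. all: by end_near. Qed.

End WeakCompactness.

(** * Subsequences and lower limits *)

Lemma increasing_seq_comp (s t : nat -> nat) :
  increasing_seq s -> increasing_seq t -> increasing_seq (s \o t).
Proof. by move=> incs inct m n; rewrite /= incs -leEnat inct. Qed.

Lemma increasing_seq_cvg (s : nat -> nat) : increasing_seq s -> s @ \oo --> \oo.
Proof.
move=> incs; have les n : (n <= s n)%N.
  elim: n => // n IHn; rewrite (leq_ltn_trans IHn)//.
  by rewrite -[X in is_true X]/(s n < s n.+1)%O; move/increasing_seqP : incs; exact.
move=> A [N _ NA]; exists N => // n /= Nn; apply: NA => /=.
exact: leq_trans Nn (les n).
Qed.

(** Otherwise some functional stays away from its value at [l] along a subsequence, and a weakly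
    convergent further subsequence contradicts this. *)
Lemma reflexive_weakly_cvg (R : realType) (X : normedModType R) (x : nat -> X)
    (l : X) (M : R) : reflexive_space X -> (forall k, `|x k| <= M) ->
  (forall (s : nat -> nat) w, increasing_seq s -> weakly_cvg (x \o s) w -> w = l) ->
  weakly_cvg x l.
Proof.
move=> reflX xM xl f; apply: contrapT => nfl.
have [e [e0 fe]] : exists e : R, 0 < e /\
    forall N, exists2 n, (N <= n)%N & e < `|f l - f (x n)|.
  apply: contrapT => nfe; apply: nfl; apply/cvgrPdist_le => e e0.
  apply: contrapT => ne; apply: nfe; exists e; split=> // N.
  apply: contrapT => nN; apply: ne; exists N => // n /= Nn.
  by rewrite leNgt; apply/negP => en; apply: nN; exists n.
have [s [incs fs]] := frequently_subseq (fun _ : nat => fe).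
have [t [w [inct wt]]] := reflexive_weakly_cvg_subseq reflX (fun k => xM (s k)).
have wl : w = l by exact: xl (increasing_seq_comp incs inct) wt.
have /cvgrPdist_le/(_ e e0)[N _ /(_ N (leqnn N))] := wt f.
by rewrite wl/= leNgt fs.
Qed.

(** Serves to exploit lower semicontinuity when [u] itself may diverge but has convergent upper
    bounds [b]. *)
Lemma le_cvg_of_limn_einf (R : realType) (a l : R) (u b : nat -> R) :
  (a%:E <= limn_einf (fun k => (u k)%:E))%E -> (forall k, u k <= b k) ->
  b @ \oo --> l -> a <= l.
Proof.
move=> au ub bl; rewrite -lee_fin (le_trans au)// limn_einf_lim.
have bE : (b k)%:E @[k --> \oo] --> l%:E by apply: cvg_EFin => //; exact: nearW.
rewrite -(cvg_lim _ bE)//; apply: lee_lim.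
- exact: is_cvg_einfs.
- by apply/cvg_ex; exists l%:E.
- apply: nearW => n; rewrite (@le_trans _ _ (u n)%:E) ?lee_fin//.
  by apply: ereal_inf_lbound; exists n => /=.
Qed.

(** * Convergence of the regularized critical points *)

Unset Implicit Arguments.

Theorem theorem3p5 (R : realType)
  (X : completeNormedModType R) (Y : metricType R)
  (S : X -> Y -> R) (Reg phi : X -> R) (p : R)
  (S_ge0 : forall x y, 0 <= S x y)
  (Reg_ge0 : forall x, 0 <= Reg x)
  (phi_ge0 : forall x, 0 <= phi x)
  (C1 : reflexive_space X)
  (C2 : weakly_seq_lsc Reg)
  (C3 : rel_subdifferentiable phi Reg)
  (C4_lsc : weakly_seq_lsc2 S)
  (C4_convex : forall y, convex_function setT (fun x => S x y))
  (C4_continuous : forall x, continuous (S x))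
  (C5_p : 1 <= p)
  (C5 : exists2 C : R, 0 < C &
     forall z y y', S z y <= C * (S z y' + mdist y y' `^ p))
  (C6 : forall (a : R) (y : Y), 0 < a -> coercive (tikhonov S Reg a y))
  (y : Y) (y_sol : exists z, S_solution S y z)
  (y_ : nat -> Y) (delta : nat -> R)
  (y_delta : forall k, mdist (y_ k) y <= delta k)
  (delta_cvg : delta k @[k --> \oo] --> (0 : R))
  (alpha : R -> R)
  (alpha_gt0 : forall k, 0 < alpha (delta k))
  (alpha_cvg : alpha (delta k) @[k --> \oo] --> (0 : R))
  (delta_alpha_cvg : (delta k `^ p / alpha (delta k)) @[k --> \oo] --> (0 : R))
  (x_ : nat -> X) (z_ : nat -> dual X)
  (z_subdiff : forall k,
     rel_subdifferential (fun u => alpha (delta k) * phi u)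
       (tikhonov S Reg (alpha (delta k)) (y_ k)) (x_ k) (z_ k))
  (z_cvg : (`|z_ k| / alpha (delta k)) @[k --> \oo] --> (0 : R))
  (z_x : forall k, z_ k (x_ k) <= 0) :
  (exists (s : nat -> nat) (x : X),
     increasing_seq s /\ weakly_cvg (x_ \o s) x) /\
  (forall (s : nat -> nat) (x : X),
     increasing_seq s -> weakly_cvg (x_ \o s) x ->
     S_solution S y x /\
     (forall u, S_solution S y u -> Reg x <= Reg u + phi u)) /\
  (forall x : X, S_solution S y x ->
     (forall u, S_solution S y u -> u = x) ->
     weakly_cvg x_ x).
Proof.
have [C C0 C5P] := C5.
have p0 : 0 <= p by rewrite (le_trans _ C5_p).
pose a k := alpha (delta k).
have a_gt0 k : 0 < a k := alpha_gt0 k.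
have a_neq0 k : a k != 0 by rewrite gt_eqF.
have mdist_powR k : mdist (y_ k) y `^ p <= delta k `^ p.
  by rewrite ge0_ler_powR ?nnegrE ?mdist_ge0// (le_trans _ (y_delta k)) ?mdist_ge0.
have y_cvg : y_ @ \oo --> y.
  apply/metricType_numDomainType.cvgrPdist_lt => e e0.
  have /cvgrPdist_lt/(_ e e0) := delta_cvg; apply: filterS => k.
  rewrite sub0r normrN metric_sym => /(le_lt_trans (ler_norm _)).
  exact: le_lt_trans.
(* Bound from the subgradient inequality at a solution [u], divided by [a k]: the first term bounds
   [S u (y_ k)] by (C5), the last one [- z_ k u]. *)
pose B u k := C * (delta k `^ p / a k) + (Reg u + phi u) + `|z_ k| / a k * `|u|.
have B_cvg u : B u @ \oo --> Reg u + phi u.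
  rewrite [X in _ --> X](_ : _ = C * 0 + (Reg u + phi u) + 0 * `|u|); last first.
    by rewrite mulr0 mul0r add0r addr0.
  by apply: cvgD; [apply: cvgD; [apply: cvgM|]|apply: cvgM];
    (exact: cvg_cst || exact: delta_alpha_cvg || exact: z_cvg).
have tikhonov_le u k : S_solution S y u ->
    S (x_ k) (y_ k) + a k * Reg (x_ k) <= a k * B u k.
  move=> uy; have := z_subdiff k u; rewrite /tikhonov linearB/= => sub.
  have Suk : S u (y_ k) <= C * delta k `^ p.
    by rewrite (le_trans (C5P u (y_ k) y))// uy add0r ler_pM2l.
  have zu : - (`|z_ k| * `|u|) <= z_ k u.
    by have := dual_norm_bound (z_ k) u; rewrite ler_norml => /andP[].
  have -> : a k * B u k =
      C * delta k `^ p + a k * (Reg u + phi u) + `|z_ k| * `|u|.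
    by rewrite /B; field.
  (* The sign of [z_ k (x_ k)] allows this term to be dropped. *)
  by have := z_x k; move: sub Suk zu; rewrite /a; lra.
have Reg_le u k : S_solution S y u -> Reg (x_ k) <= B u k.
  move=> uy; rewrite -(ler_pM2l (a_gt0 k)).
  by rewrite (le_trans _ (tikhonov_le u k uy))// lerDr.
have S_le u k : S_solution S y u -> S (x_ k) (y_ k) <= a k * B u k.
  move=> uy; rewrite (le_trans _ (tikhonov_le u k uy))// lerDl.
  by rewrite mulr_ge0// ltW.
have aB_cvg u : (a k * B u k) @[k --> \oo] --> (0 : R).
  by rewrite -(mul0r (Reg u + phi u)); apply: cvgM; [exact: alpha_cvg|exact: B_cvg].
have [M xM] : exists M, forall k, `|x_ k| <= M.
  have [u uy] := y_sol.
  (* (C5) passes from [y_ k] to [y]; the power of [delta k] is written as a product of two null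
     sequences. *)
  pose D k := C * (a k * B u k + a k * (delta k `^ p / a k)) + B u k.
  have D_cvg : cvg (D @ \oo).
    apply/cvg_ex; exists (C * (0 + 0 * 0) + (Reg u + phi u)).
    apply: cvgD; last exact: B_cvg.
    apply: cvgM; first exact: cvg_cst.
    apply: cvgD; first exact: aB_cvg.
    by apply: cvgM; [exact: alpha_cvg|exact: delta_alpha_cvg].
  have T_le k : tikhonov S Reg 1 y (x_ k) <= D k.
    rewrite /tikhonov mul1r lerD ?Reg_le// (le_trans (C5P _ y (y_ k)))//.
    by rewrite ler_pM2l// lerD ?S_le// metric_sym mulrCA divff// mulr1.
  have /cvg_seq_bounded/pinfty_ex_gt0[K K0 DK] := D_cvg.
  (* The level [K + 1] exceeds every [D k], so no [x_ k] has norm above [r]. *)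
  have [r rP] := C6 1 y ltr01 (K + 1).
  exists r => k; rewrite leNgt; apply/negP => /ltW /rP.
  rewrite leNgt => /negP; apply; rewrite (le_lt_trans (T_le k))//.
  by rewrite (le_lt_trans (ler_norm _))// (le_lt_trans (DK k _))// ltrDl.
have limitP (s : nat -> nat) x : increasing_seq s -> weakly_cvg (x_ \o s) x ->
    S_solution S y x /\ forall u, S_solution S y u -> Reg x <= Reg u + phi u.
  move=> incs sx; have s_cvg := increasing_seq_cvg incs; split=> [|u uy].
    (* Any one solution [u] provides the null sequence [a k * B u k] above [S (x_ k) (y_ k)]. *)
    have [u uy] := y_sol; apply/eqP; rewrite eq_le S_ge0 andbT.
    apply: (le_cvg_of_limn_einf (C4_lsc _ _ (y_ \o s) y sx _)).
    - exact: cvg_comp s_cvg y_cvg.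
    - by move=> k; exact: S_le uy.
    - exact: cvg_comp s_cvg (aB_cvg u).
  apply: (le_cvg_of_limn_einf (C2 _ _ sx)) => [k|]; first exact: Reg_le uy.
  exact: cvg_comp s_cvg (B_cvg u).
split; first exact: reflexive_weakly_cvg_subseq C1 xM.
split=> // x xy xuniq; apply: (reflexive_weakly_cvg C1 xM) => s w incs sw.
by apply: xuniq; have [] := limitP s w incs sw.
Qed.
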